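(* With the stable bundle $E^s(\lambda,z)$, the unstable bundle $E^u(\lambda,z)$ and the symplectic form $\omega$ as in the context, both $E^s(\lambda,z)$ and $E^u(\lambda,z)$ are $\omega$-Lagrangian subspaces of $\mathbb R^4$ for all $\lambda\in I$ and all $z\in\mathbb R$.
   Context: Setting. Let $f,g\in C^2(\mathbb R)$ and $\alpha,\sigma>0$, and consider $u_t=u_{xx}+f(u)-\sigma v$, $v_t=v_{xx}+g(v)+\alpha u$. Here $(0,0)$ is an equilibrium with $f'(0)+g'(0)<0$ and $f'(0)g'(0)+\sigma\alpha>0$. The system has a traveling wave $\varphi=(\hat u,\hat v)$ of speed $c$, a nonconstant solution depending only on $z=x-ct$ and decaying exponentially to $(0,0)$ as $z\to\pm\infty$. Thus, also writing $\varphi=(\hat u,\hat v,\hat u'/\sigma,\hat v'/\alpha)$, $\varphi$ is an orbit homoclinic to $0\in\mathbb R^4$ of the system (TW): $u'=\sigma w$, $v'=\alpha y$, $w'=-cw-f(u)/\sigma+v$, $y'=-cy-u-g(v)/\alpha$. Let $\nu_1,\nu_2$ be the eigenvalues of $\begin{pmatrix}f'(0)&-\sigma\\ \alpha&g'(0)\end{pmatrix}$. Standing assumptions: (A1) $c<0$. (A2) $\nu_1,\nu_2$ are real and simple, with $\nu_1<\nu_2<0$. For real $\lambda>\nu_2$ set $\mu_{1}(\lambda)=-\frac c2-\frac12\sqrt{c^2+4(\lambda-\nu_1)}$, $\mu_{2}(\lambda)=-\frac c2-\frac12\sqrt{c^2+4(\lambda-\nu_2)}$, $\mu_{3}(\lambda)=-\frac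 c2+\frac12\sqrt{c^2+4(\lambda-\nu_2)}$, $\mu_{4}(\lambda)=-\frac c2+\frac12\sqrt{c^2+4(\lambda-\nu_1)}$. (A3) The exponential decay rate of $\varphi$ is exactly $\mu_2(0)$ as $z\to+\infty$ and exactly $\mu_3(0)$ as $z\to-\infty$. (A4) $\varphi$ is transversely constructed: for (TW) augmented with $c'=0$ (in $\mathbb R^5$), the curve $(\varphi(z),c)$ is given by the transverse intersection of the center-unstable and center-stable manifolds of the fixed point $(0,0,0,0,c)$. Linearized system. For $\lambda\in\mathbb R$ consider $Y'=A(\lambda,z)Y$ on $\mathbb R^4$ with $$A(\lambda,z)=\begin{pmatrix}0&0&\sigma&0\\0&0&0&\alpha\\ \frac{\lambda-f'(\hat u(z))}{\sigma}&1&-c&0\\-1&\frac{\lambda-g'(\hat v(z))}{\alpha}&0&-c\end{pmatrix},\qquad A_\infty(\lambda)=\lim_{z\to\pm\infty}A(\lambda,z).$$ The eigenvalues of $A_\infty(\lambda)$ are $\mu_1(\lambda),\dots,\mu_4(\lambda)$. Fix $\delta>0$ small so that on $I=[-\delta,\infty)$ these are real and simple with $\mu_1<\mu_2<0<\mu_3<\mu_4$. For $\lambda\in I$, $u_i(\lambda,z)$ are solutions of $Y'=A(\lambda,z)Y$, analytic in $\lambda$, with $\lim_{z\to+\infty}e^{-\mu_i(\lambda)z}u_i(\lambda,z)=\eta_i(\lambda)$ for $i=1,2$ and $\lim_{z\to-\infty}e^{-\mu_i(\lambda)z}u_i(\lambda,z)=\eta_i(\lambda)$ for $i=3,4$, uniformly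 on compact subsets of $I$, where $\eta_i(\lambda)$ is a nonzero eigenvector of $A_\infty(\lambda)$ for $\mu_i(\lambda)$. Define $E^s(\lambda,z)=\mathrm{span}\{u_1(\lambda,z),u_2(\lambda,z)\}$ (stable bundle) and $E^u(\lambda,z)=\mathrm{span}\{u_3(\lambda,z),u_4(\lambda,z)\}$ (unstable bundle). Symplectic form on $\mathbb R^4$: $\omega(a,b)=(a_1b_3-a_3b_1)-(a_2b_4-a_4b_2)$. A two-dimensional subspace $V\subset\mathbb R^4$ is $\omega$-Lagrangian if $\omega(a,b)=0$ for all $a,b\in V$. *)

(* Defs.v *)
From HB Require Import structures.
From mathcomp Require Import all_boot all_order all_algebra.
From mathcomp Require Import all_classical all_reals all_analysis.
Set Implicit Arguments. Unset Strict Implicit. Unset Printing Implicit Defensive.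
Import Order.TTheory GRing.Theory Num.Theory.
Import numFieldNormedType.Exports.
Local Open Scope classical_set_scope.
Local Open Scope ring_scope.

Definition col_of_seq (R : realType) (n : nat) (s : seq R) : 'cV[R]_n :=
  \col_(i < n) s`_i.

Definition mx_of_seq (R : realType) (n : nat) (s : seq (seq R)) : 'M[R]_n :=
  \matrix_(i < n, j < n) (nth [::] s i)`_j.

Definition C2_fun (R : realType) (f : R -> R) : Prop :=
  [/\ forall x, derivable f x 1,
      forall x, derivable (derive1 f) x 1 &
      continuous (derive1 (derive1 f))].

Definition C1_map (R : realType) (n : nat)
    (h : 'cV[R]_n.+1 -> 'cV[R]_n.+1) : Prop :=
  (forall x, differentiable h x) /\
  (forall v, continuous (fun x => 'd h x v)).

Section TravelingWave.
Variables (R : realType) (f g : R -> R) (sigma alpha : R).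

(* Classical solutions of u_t = u_xx + f(u) - sigma v, v_t = v_xx + g(v) + alpha u;
   the arguments of u and v are x, then t. *)
Definition RD_solution (u v : R -> R -> R) : Prop :=
  forall x t : R,
    [/\ [/\ derivable (u x) t 1, derivable (u^~ t) x 1 &
            derivable (derive1 (u^~ t)) x 1],
        [/\ derivable (v x) t 1, derivable (v^~ t) x 1 &
            derivable (derive1 (v^~ t)) x 1],
        derive1 (u x) t = derive1 (derive1 (u^~ t)) x + f (u x t) - sigma * v x t &
        derive1 (v x) t = derive1 (derive1 (v^~ t)) x + g (v x t) + alpha * u x t].

Definition traveling_wave (c : R) (uh vh : R -> R) : Prop :=
  [/\ RD_solution (fun x t => uh (x - c * t)) (fun x t => vh (x - c * t)),
      ~ (exists a b : R, forall z, uh z = a /\ vh z = b) &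
      exists C k : R, 0 < k /\
        forall z, `|uh z| + `|vh z| <= C * expR (- k * `|z|)].

Definition wave_orbit (uh vh : R -> R) (z : R) : 'cV[R]_4 :=
  col_of_seq 4 [:: uh z; vh z; derive1 uh z / sigma; derive1 vh z / alpha].

Definition wave_orbit_aug (c : R) (uh vh : R -> R) (z : R) : 'cV[R]_5 :=
  col_of_seq 5 [:: uh z; vh z; derive1 uh z / sigma; derive1 vh z / alpha; c].

(* The vector field of the traveling wave system augmented with c' = 0:
   the coordinates of x are (u, v, w, y, c). *)
Definition TW_aug (x : 'cV[R]_5) : 'cV[R]_5 :=
  let u := x (inord 0) 0 in let v := x (inord 1) 0 in
  let w := x (inord 2) 0 in let y := x (inord 3) 0 in
  let c := x (inord 4) 0 in
  col_of_seq 5 [:: sigma * w;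
                   alpha * y;
                   - c * w - f u / sigma + v;
                   - c * y - u - g v / alpha;
                   0].

Definition reaction_jacobian : 'M[R]_2 :=
  mx_of_seq 2 [:: [:: derive1 f 0; - sigma];
                  [:: alpha; derive1 g 0]].

Definition linearized_mx (c : R) (uh vh : R -> R) (lam z : R) : 'M[R]_4 :=
  mx_of_seq 4
    [:: [:: 0; 0; sigma; 0];
        [:: 0; 0; 0; alpha];
        [:: (lam - derive1 f (uh z)) / sigma; 1; - c; 0];
        [:: -1; (lam - derive1 g (vh z)) / alpha; 0; - c]].

End TravelingWave.

Section SpatialEigenvalues.
Variables (R : realType) (c nu1 nu2 : R).

Definition mu1 (lam : R) : R := - c / 2 - Num.sqrt (c ^+ 2 + 4 * (lam - nu1)) / 2.
Definition mu2 (lam : R) : R := - c / 2 - Num.sqrt (c ^+ 2 + 4 * (lam - nu2)) / 2.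
Definition mu3 (lam : R) : R := - c / 2 + Num.sqrt (c ^+ 2 + 4 * (lam - nu2)) / 2.
Definition mu4 (lam : R) : R := - c / 2 + Num.sqrt (c ^+ 2 + 4 * (lam - nu1)) / 2.

End SpatialEigenvalues.

Section InvariantManifolds.
Variables (R : realType) (n : nat).
Let V : normedModType R := 'cV[R]_n.+1.
Implicit Types (F : V -> V) (X : R -> V) (W : set V) (p v : V).

Definition solves_on F (a b : R) X : Prop :=
  forall t : R, a <= t <= b -> is_derive t (1 : R) X (F (X t)).

(* The span of the eigenvectors of DF(p) whose (real) eigenvalue lies in S.
   For S = ]-oo, 0] this is the center-stable subspace and for S = ]0, +oo[ the
   unstable one, provided that DF(p) is diagonalizable over R; this is the case
   for TW_aug at (0, 0, 0, 0, c), where the eigenvalues are 0, mu1 0, ..., mu4 0. *)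
Definition spectral_span F p (S : set R) : set V :=
  [set v | exists w : 'I_n.+1 -> V,
     (forall i, exists a : R, S a /\ 'd F p (w i) = a *: w i) /\
     v = \sum_i w i].

(* W is a (local) center-stable manifold of the equilibrium p of x' = F x: a C^1
   graph over the center-stable subspace, tangent to it at p, and locally
   invariant in a neighborhood U of p. *)
Definition center_stable_manifold F p W : Prop :=
  exists (U : set V) (h : V -> V),
  [/\ open U /\ U p,
      [/\ C1_map h, h 0 = 0 & forall v, 'd h 0 v = 0],
      forall v, spectral_span F p [set a | a <= 0] v ->
                spectral_span F p [set a | 0 < a] (h v),
      W = [set x | U x /\
             exists v, spectral_span F p [set a | a <= 0] v /\ x = p + v + h v] &
      forall (a b t0 : R) X, solves_on F a b X ->
        (forall t, a <= t <= b -> U (X t)) ->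
        a <= t0 <= b -> W (X t0) ->
        forall t, a <= t <= b -> W (X t)].

(* v is tangent at X z to the global center-stable manifold, i.e. the union of
   the preimages of W under the flow, along a solution X that tends to p: v is
   the velocity of a curve of points that the flow carries into W in the common
   time T - z. Only large T matter, so that only the germ of W at p does. *)
Definition center_stable_tangent F W X (z : R) v : Prop :=
  \forall T \near +oo_R, exists G : R -> R -> V,
  [/\ \forall s \near (0 : R), solves_on F z T (G s) /\ W (G s T),
      G 0 z = X z &
      is_derive (0 : R) (1 : R) (fun s => G s z) v].

(* Center-unstable objects of F are center-stable objects of - F, with time
   reversed. *)
Definition transverse_homoclinic F p X : Prop :=
  let F' := fun x => - F x in
  let X' := fun z => X (- z) in
  exists Wcs Wcu : set V,
  [/\ center_stable_manifold F p Wcs,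
      center_stable_manifold F' p Wcu,
      (forall z, is_derive z (1 : R) X (F (X z))) /\
      [/\ X z @[z --> +oo_R] --> p, X z @[z --> -oo_R] --> p,
          \forall z \near +oo_R, Wcs (X z) &
          \forall z \near +oo_R, Wcu (X' z)] &
      forall (z : R) (x : V), exists v v' : V,
        [/\ center_stable_tangent F Wcs X z v,
            center_stable_tangent F' Wcu X' (- z) v' &
            x = v + v']].

End InvariantManifolds.

Section Bundles.
Variable R : realType.

(* At a left endpoint of I the expansion is only required to represent y on I,
   which amounts to an analytic continuation of y past the endpoint. *)
Definition analytic_on (I : set R) (y : R -> 'cV[R]_4) : Prop :=
  forall l0, I l0 -> exists (r : R) (a : nat -> 'cV[R]_4), 0 < r /\
    forall l, I l -> `|l - l0| < r ->
      series (fun k => (l - l0) ^+ k *: a k) m @[m --> \oo] --> y l.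

(* u lam is, for lam in I, a solution of Y' = A lam z Y analytic in lam, with
   exp(- mu lam z) u lam z --> eta lam along the filter E (z to +oo or -oo),
   uniformly on compact subsets of I. *)
Definition asymptotic_solution (I : set R) (A : R -> R -> 'M[R]_4)
    (Ainf : R -> 'M[R]_4) (E : set_system R) (mu : R -> R)
    (eta : R -> 'cV[R]_4) (u : R -> R -> 'cV[R]_4) : Prop :=
  [/\ forall lam z : R, I lam ->
        is_derive z (1 : R) (u lam) (A lam z *m u lam z),
      forall z : R, analytic_on I (u^~ z),
      forall K : set R, compact K -> K `<=` I ->
        forall e : R, 0 < e -> \forall z \near E, forall lam, K lam ->
          `|expR (- mu lam * z) *: u lam z - eta lam| < e &
      forall lam, I lam ->
        eta lam != 0 /\ Ainf lam *m eta lam = mu lam *: eta lam].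

Definition bundle (ui uj : R -> R -> 'cV[R]_4) (lam z : R) : {vspace 'cV[R]_4} :=
  <<[:: ui lam z; uj lam z]>>%VS.

Definition omega (a b : 'cV[R]_4) : R :=
  let x (w : 'cV[R]_4) (i : nat) := w (inord i) 0 in
  (x a 0%N * x b 2%N - x a 2%N * x b 0%N)
  - (x a 1%N * x b 3%N - x a 3%N * x b 1%N).

Definition lagrangian (V : {vspace 'cV[R]_4}) : Prop :=
  \dim V = 2%N /\ forall a b, a \in V -> b \in V -> omega a b = 0.

End Bundles.

(* Main.v *)
(* The coefficient matrix A of the linearized system satisfies
   omega(A a, b) + omega(a, A b) = - c omega(a, b), so e^(c z) omega(Y, Y') is
   constant along any two solutions.  For a pair of solutions growing like
   e^(m z) and e^(m' z) it is of order e^((m + m' + c) z), and since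
   mu1 + mu2 + c < 0 < mu3 + mu4 + c this tends to 0 at the relevant end of the
   line; hence omega(Y, Y') = 0.  The bundles are two-dimensional because a
   linear combination vanishing at one point vanishes identically (uniqueness,
   by Gronwall), and the two distinct exponential rates then force its
   coefficients to be 0. *)
Require Import Defs.
From HB Require Import structures.
From mathcomp Require Import all_boot all_order all_algebra.
From mathcomp Require Import all_classical all_reals all_analysis.
From mathcomp Require Import ring lra.
Set Implicit Arguments.
Unset Strict Implicit.
Import Order.TTheory GRing.Theory Num.Theory.
Import numFieldNormedType.Exports.
Local Open Scope classical_set_scope.
Local Open Scope ring_scope.

(** * Derivative rules and uniqueness for linear differential equations *)

Lemma is_derive_entry {R : realType} m n (M : R -> 'M[R]_(m, n)) (t : R)
    (dM : 'M[R]_(m, n)) i j :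
  is_derive t (1 : R) M dM -> is_derive t (1 : R) (fun x => M x i j) (dM i j).
Proof.
move=> [Mt DM]; apply: DeriveDef; first by move/derivable_mxP : Mt; apply.
by rewrite -DM derive_mx// mxE.
Qed.

Lemma is_derive_expRM {R : realType} (k x : R) :
  is_derive x (1 : R) (fun t => expR (k * t)) (expR (k * x) * k).
Proof.
apply: is_derive1_comp.
have := is_deriveZ k (is_derive_id x (1 : R)).
by move=> /is_derive_eq; apply; rewrite /GRing.scale /= mulr1.
Qed.

(** Gronwall's argument: [e^(- K x) * N x] has derivative [e^(- K x) * (dN x - K * N x)], so it is
    nonincreasing on [[a, b]], and the exponential factor does not affect signs. *)
Lemma gronwall_le0 {R : realType} (N dN : R -> R) (K a b : R) :
  (forall x, is_derive x (1 : R) N (dN x)) ->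
  (forall x, a <= x <= b -> dN x <= K * N x) ->
  a <= b -> N a <= 0 -> N b <= 0.
Proof.
move=> NdN dNle ab Na.
pose F x := expR (- K * x) * N x.
have FdF x : is_derive x (1 : R) F (expR (- K * x) * (dN x - K * N x)).
  have := is_deriveM (is_derive_expRM (- K) x) (NdN x); rewrite /F.
  by move=> /is_derive_eq; apply; rewrite /GRing.scale /=; ring.
have : F b <= F a.
  apply: (@ler0_derive1_le_cc R F a b) => //; rewrite ?in_itv/= ?lexx ?ab//.
  - move=> x; rewrite in_itv/= => /andP[ax xb].
    rewrite derive1E (@derive_val _ _ _ _ _ _ _ (FdF x)).
    by rewrite pmulr_rle0 ?expR_gt0// subr_le0 dNle// !ltW.
  - apply: derivable_within_continuous => x _; exact: ex_derive.
move=> FbFa; have : F b <= 0.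
  by rewrite (le_trans FbFa)// pmulr_rle0 ?expR_gt0.
by rewrite pmulr_rle0 ?expR_gt0.
Qed.

(** The squared Euclidean norm [N] of [w] satisfies [|N'| <= 2 * S * N], with [S] the sum of the
    absolute values of the entries of [A]. As the bound is two-sided, Gronwall applies in both
    directions of time. *)
Lemma linear_ode_eq0 {R : realType} n (A : R -> 'M[R]_n) (w : R -> 'cV[R]_n)
    (a b : R) :
  (forall i j, continuous (fun x => A x i j)) ->
  (forall x, is_derive x (1 : R) w (A x *m w x)) ->
  w a = 0 -> w b = 0.
Proof.
move=> Acont wA wa0.
pose N x := \sum_(i < n) w x i 0 ^+ 2.
pose dN x := \sum_(i < n) (2 * w x i 0 * (A x *m w x) i 0).
pose S x := \sum_(i < n) \sum_(j < n) `|A x i j|.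
have NdN x : is_derive x (1 : R) N (dN x).
  have -> : N = \sum_(i < n) (fun x => w x i 0) ^+ 2.
    by apply/funext => y; rewrite fct_sumE.
  apply: is_derive_sum => i.
  have := is_deriveX 2 (is_derive_entry i 0 (wA x)).
  by move=> /is_derive_eq; apply; rewrite /GRing.scale /= expr1.
have N_ge0 x : 0 <= N x by apply: sumr_ge0 => i _; exact: sqr_ge0.
have dNS x : `|dN x| <= 2 * S x * N x.
  rewrite (le_trans (ler_norm_sum _ _ _))//.
  rewrite [2 * S x]mulr_sumr mulr_suml ler_sum// => i _.
  rewrite mxE mulr_sumr (le_trans (ler_norm_sum _ _ _))//.
  rewrite [2 * \sum_(_ < _) _]mulr_sumr mulr_suml ler_sum// => j _.
  have wN k : w x k 0 ^+ 2 <= N x.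
    rewrite /N (bigD1 k)//= lerDl; apply: sumr_ge0 => l _; exact: sqr_ge0.
  have -> : 2 * w x i 0 * (A x i j * w x j 0) =
            2 * A x i j * (w x i 0 * w x j 0) by ring.
  rewrite normrM [`|2 * _|]normrM ger0_norm// ler_wpM2l ?mulr_ge0//.
  have := wN i; have := wN j; set p := w x i 0; set q := w x j 0 => ? ?.
  (* Here [2 * |p * q| <= p ^+ 2 + q ^+ 2 <= 2 * N x]. *)
  by rewrite ler_norml; apply/andP; split; nra.
have Scont : continuous S.
  apply: continuous_big => [|i _]; first exact: add_continuous.
  apply: continuous_big => [|j _ x]; first exact: add_continuous.
  by apply: cvg_norm; exact: Acont.
(* Sorting the endpoints yields one bound [K] for both orders of [a] and [b]. *)
have [K SK] : exists K, forall x, Num.min a b <= x <= Num.max a b -> S x <= K.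
  have ab : Num.min a b <= Num.max a b by rewrite ge_min le_max lexx.
  have [m _ Sm] := EVT_max ab (continuous_subspaceT Scont).
  by exists (S m) => x xab; apply: Sm; rewrite in_itv.
have Na0 : N a = 0.
  by rewrite /N big1// => i _; rewrite wa0 mxE expr0n.
suff Nb : N b <= 0.
  have /eqP : N b = 0 by apply/eqP; rewrite eq_le Nb N_ge0.
  rewrite psumr_eq0 => [/allP w0|i _]; last exact: sqr_ge0.
  apply/matrixP => i j; rewrite ord1 mxE.
  by have /= := w0 i (mem_index_enum _); rewrite sqrf_eq0 => /eqP.
have [ab|/ltW ba] := leP a b.
- apply: (gronwall_le0 (K := 2 * K) NdN _ ab); last by rewrite Na0.
  move=> x xab; rewrite (le_trans (ler_norm _))// (le_trans (dNS x))//.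
  by rewrite ler_wpM2r// ler_pM2l// SK// (min_idPl ab) (max_idPr ab).
(* Backward case: time is reflected, and Gronwall runs from [- a] to [- b]. *)
- have NdNV x : is_derive x (1 : R) (fun t => N (- t)) (- dN (- x)).
    have Nx := NdN (- x).
    have := is_derive1_comp Nx (is_deriveN (is_derive_id x (1 : R))).
    by move=> /is_derive_eq; apply; rewrite mulrN1.
  have -> : N b = (fun t => N (- t)) (- b) by rewrite /= opprK.
  apply: (gronwall_le0 (K := 2 * K) NdNV (a := - a)).
  + move=> x /andP[ax xb].
    rewrite (le_trans (ler_norm _))// normrN (le_trans (dNS _))//.
    rewrite ler_wpM2r// ler_pM2l// SK// (min_idPr ba) (max_idPl ba).
    by rewrite lerNr xb lerNl ax.
  + by rewrite lerN2.
  + by rewrite opprK Na0.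
Qed.

(** * Algebra and calculus of the symplectic form *)

Section Omega.
Variable R : realType.
Implicit Types a b : 'cV[R]_4.

Lemma omegaDl a a' b : omega (a + a') b = omega a b + omega a' b.
Proof. by rewrite /omega !mxE; ring. Qed.

Lemma omegaZl k a b : omega (k *: a) b = k * omega a b.
Proof. by rewrite /omega !mxE; ring. Qed.

Lemma omegaC a b : omega a b = - omega b a.
Proof. by rewrite /omega; ring. Qed.

Lemma mul_mx_of_seqE (s : seq (seq R)) a k : (k < 4)%N ->
  (mx_of_seq 4 s *m a) (inord k) 0 =
  \sum_(0 <= j < 4) (nth [::] s k)`_j * a (inord j) 0.
Proof.
move=> k4; rewrite mxE big_mkord; apply: eq_bigr => j _.
by rewrite mxE inordK// inord_val.
Qed.

(** The entries [1] and [-1] coupling the two components cancel thanks to the minus sign between the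
    two planes in [omega]. The entries [sigma], [alpha] and the two quotients cancel by
    antisymmetry, so that only the damping [- c] survives. *)
Lemma omega_linearized f g (sigma alpha c : R) uh vh lam z a b :
  let A := linearized_mx f g sigma alpha c uh vh lam z in
  omega (A *m a) b + omega a (A *m b) = - c * omega a b.
Proof.
(* Unlocking the big operators lets the four-term row sums compute; the coordinates and quotients
   then become atoms of a polynomial identity. *)
rewrite /= /linearized_mx /omega !mul_mx_of_seqE// unlock /=.
move: (a _ _) (a _ _) (a _ _) (a _ _) => a0 a1 a2 a3.
move: (b _ _) (b _ _) (b _ _) (b _ _) => b0 b1 b2 b3.
move: (_ / sigma) (_ / alpha) => p q.
by ring.
Qed.

Lemma is_derive_omega (u v : R -> 'cV[R]_4) z du dv :
  is_derive z (1 : R) u du -> is_derive z (1 : R) v dv ->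
  is_derive z (1 : R) (fun t => omega (u t) (v t))
    (omega du (v z) + omega (u z) dv).
Proof.
move=> Du Dv; rewrite /omega.
have Dm i j := is_deriveM (is_derive_entry (inord i) 0 Du)
                          (is_derive_entry (inord j) 0 Dv).
have := is_deriveB (is_deriveB (Dm 0%N 2%N) (Dm 2%N 0%N))
                   (is_deriveB (Dm 1%N 3%N) (Dm 3%N 1%N)).
by move=> /is_derive_eq; apply; rewrite /GRing.scale /=; ring.
Qed.

Lemma cvg_omega {T : Type} (F : set_system T) (u v : T -> 'cV[R]_4) a b :
  Filter F -> u @ F --> a -> v @ F --> b ->
  omega (u t) (v t) @[t --> F] --> omega a b.
Proof.
move=> FF ua vb; rewrite /omega.
have ent (w : T -> 'cV[R]_4) (l : 'cV[R]_4) i :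
    w @ F --> l -> w t (inord i) 0 @[t --> F] --> l (inord i) 0.
  by move=> wl; exact: (cvg_comp _ _ wl (@coord_continuous _ _ _ (inord i) 0 l)).
by apply: cvgB; apply: cvgB; apply: cvgM; exact: ent.
Qed.

(** By bilinearity and antisymmetry, [omega (k a + l b) (m a + n b)] equals
    [(k n - l m) * omega a b]. *)
Lemma lagrangian_span (a b : 'cV[R]_4) :
  free [:: a; b] -> omega a b = 0 -> lagrangian <<[:: a; b]>>%VS.
Proof.
move=> ab_free ab0; split.
  by move: ab_free; rewrite /free => /eqP ->.
have self0 x : omega x x = 0 by rewrite /omega; ring.
move=> x y; rewrite !span_cons span_nil addv0.
move=> /memv_addP[_ /vlineP[k ->] [_ /vlineP[l ->] ->]].
move=> /memv_addP[_ /vlineP[m ->] [_ /vlineP[n ->] ->]].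
rewrite omegaDl !omegaZl [omega a _]omegaC [omega b _]omegaC !omegaDl !omegaZl.
by rewrite !self0 [omega b a]omegaC ab0; ring.
Qed.

End Omega.

(** * Two solutions with given exponential rates along [E], which stands for either end of the
    line *)

Section Solutions.
Variables (R : realType) (f g : R -> R) (sigma alpha c : R) (uh vh : R -> R).
Variables (lam : R) (E : set_system R) (m m' : R) (eta eta' : 'cV[R]_4).
Variables (u u' : R -> 'cV[R]_4).
Context {FE : ProperFilter E}.
Let A := linearized_mx f g sigma alpha c uh vh lam.
Hypothesis u_sol : forall z, is_derive z (1 : R) u (A z *m u z).
Hypothesis u'_sol : forall z, is_derive z (1 : R) u' (A z *m u' z).
Hypothesis u_lim : expR (- m * z) *: u z @[z --> E] --> eta.
Hypothesis u'_lim : expR (- m' * z) *: u' z @[z --> E] --> eta'.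

Lemma omega_solutions_eq0 :
  expR ((m + m' + c) * z) @[z --> E] --> 0 -> forall z, omega (u z) (u' z) = 0.
Proof.
move=> E0 z.
pose W t := expR (c * t) * omega (u t) (u' t).
have DW t : is_derive t (1 : R) W 0.
  have DM := is_deriveM (is_derive_expRM c t)
    (is_derive_omega (u_sol t) (u'_sol t)).
  apply: (is_derive_eq DM).
  by rewrite omega_linearized /GRing.scale /=; ring.
have Wz : W t @[t --> E] --> W z.
  have -> : W = cst (W z).
    by apply/funext => t; exact: is_derive_0_is_cst.
  exact: cvg_cst.
have W0 : W t @[t --> E] --> 0.
  (* The limit is put in product form: rescaling both solutions leaves the factor
     [e^((m + m' + c) t)], which tends to 0, times a form converging to [omega eta eta']. *)
  rewrite -(mul0r (omega eta eta')).
  have WE t : W t = expR ((m + m' + c) * t) *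
      omega (expR (- m * t) *: u t) (expR (- m' * t) *: u' t).
    rewrite /W omegaZl [omega (u t) (_ *: _)]omegaC omegaZl -mulrN -omegaC.
    by rewrite !mulrA -!expRD; congr (expR _ * _); ring.
  under eq_cvg do rewrite WE.
  exact: cvgM E0 (cvg_omega _ u_lim u'_lim).
apply: (mulfI (lt0r_neq0 (expR_gt0 (c * z)))); rewrite mulr0.
exact: (cvg_unique (@norm_hausdorff _ _) Wz W0).
Qed.

(** The order of the pair matters: the hypothesis on [m - m'] makes [u] negligible against [u']
    along [E]. *)
Lemma free_solutions :
  (forall i j, continuous (fun z => A z i j)) -> eta != 0 -> eta' != 0 ->
  expR ((m - m') * z) @[z --> E] --> 0 -> forall z, free [:: u z; u' z].
Proof.
move=> Acont eta0 eta'0 E0 z.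
have comb k l : k *: u z + l *: u' z = 0 -> k = 0 /\ l = 0.
  move=> kl0; pose w t := k *: u t + l *: u' t.
  have w0 t : w t = 0.
    apply: (linear_ode_eq0 t Acont _ kl0) => x.
    have := is_deriveD (is_deriveZ k (u_sol x)) (is_deriveZ l (u'_sol x)).
    by move=> /is_derive_eq; apply; rewrite /w mulmxDr -!scalemxAr.
  (* At the dominant rate [m'] the rescaled combination tends to [l *: eta'], yet it is identically
     0. *)
  have l0 : l = 0.
    have lim_w : expR (- m' * t) *: w t @[t --> E]
        --> (k * 0) *: eta + l *: eta'.
      have wE t : expR (- m' * t) *: w t =
          (k * expR ((m - m') * t)) *: (expR (- m * t) *: u t) +
          l *: (expR (- m' * t) *: u' t).
        rewrite /w scalerDr !scalerA -mulrA -expRD [l * _]mulrC [k * _]mulrC.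
        by congr ((expR _ * _) *: _ + _); ring.
      under eq_cvg do rewrite wE.
      exact: cvgD (cvgZ (cvgM (cvg_cst k) E0) u_lim) (cvgZ (cvg_cst l) u'_lim).
    have : expR (- m' * t) *: w t @[t --> E] --> (0 : 'cV[R]_4).
      by under eq_cvg do rewrite w0 scaler0; exact: cvg_cst.
    move=> /(cvg_unique (@norm_hausdorff _ _) lim_w) /eqP.
    by rewrite mulr0 scale0r add0r scaler_eq0 (negbTE eta'0) orbF => /eqP.
  split=> //.
  (* With the dominant term gone, rescaling at the rate [m] isolates [k]. *)
  have lim_w : expR (- m * t) *: w t @[t --> E] --> k *: eta.
    have wE t : expR (- m * t) *: w t = k *: (expR (- m * t) *: u t).
      by rewrite /w l0 scale0r addr0 !scalerA mulrC.
    by under eq_cvg do rewrite wE; exact: cvgZ (cvg_cst k) u_lim.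
  have : expR (- m * t) *: w t @[t --> E] --> (0 : 'cV[R]_4).
    by under eq_cvg do rewrite w0 scaler0; exact: cvg_cst.
  move=> /(cvg_unique (@norm_hausdorff _ _) lim_w) /eqP.
  by rewrite scaler_eq0 (negbTE eta0) orbF => /eqP.
rewrite free_cons span_seq1 seq1_free; apply/andP; split.
  apply/vlineP => -[k uk].
  have uk0 : 1 *: u z + - k *: u' z = 0 by rewrite uk scale1r scaleNr subrr.
  by have [/eqP] := comb _ _ uk0; rewrite oner_eq0.
apply/eqP => u'0.
have u0 : 0 *: u z + 1 *: u' z = 0 by rewrite u'0 scale0r scaler0 addr0.
by have [_ /eqP] := comb _ _ u0; rewrite oner_eq0.
Qed.

End Solutions.

(** * Limits and continuity extracted from the hypotheses on the wave and the solutions *)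

Lemma asymptotic_solution_lim {R : realType} (I : set R) A Ainf
    (E : set_system R) mu eta u lam :
  asymptotic_solution I A Ainf E mu eta u -> I lam -> Filter E ->
  expR (- mu lam * z) *: u lam z @[z --> E] --> eta lam.
Proof.
move=> [_ _ lim_u _] Ilam FE; apply/cvgrPdist_lt => e e0.
have KI : [set lam] `<=` I by move=> _ ->.
have := lim_u _ (@compact_set1 _ lam) KI e e0.
by apply: filterS => z /(_ lam erefl); rewrite distrC.
Qed.

Lemma traveling_wave_continuous {R : realType} (f g : R -> R) sigma alpha c uh vh :
  traveling_wave f g sigma alpha c uh vh -> continuous uh /\ continuous vh.
Proof.
(* The slice of the wave at time 0 is its profile, which thus inherits the differentiability in
   space of a classical solution. *)
move=> [sol _ _]; have at0 (h : R -> R) : (fun x => h (x - c * 0)) = h.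
  by apply/funext => x; rewrite mulr0 subr0.
by split=> x; have [[_ + _] [_ + _] _ _] := sol x 0; rewrite !at0 => du dv;
  apply/differentiable_continuous/derivable1_diffP.
Qed.

(** Supplies the continuity of coefficients behind uniqueness. Only the entries containing [f'] and
    [g'] vary with [z], and these derivatives are continuous because they are differentiable. *)
Lemma linearized_mx_continuous {R : realType} (f g : R -> R) sigma alpha c uh vh
    lam :
  C2_fun f -> C2_fun g -> traveling_wave f g sigma alpha c uh vh ->
  forall i j, continuous (fun z => linearized_mx f g sigma alpha c uh vh lam z i j).
Proof.
move=> [_ f'd _] [_ g'd _] /traveling_wave_continuous[uhc vhc].
have C1 (h w : R -> R) k : (forall x, derivable (derive1 h) x 1) ->
    continuous w -> continuous (fun z => (lam - derive1 h (w z)) / k).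
  move=> h'd wc z; apply: cvgM; last exact: cvg_cst.
  apply: cvgB; first exact: cvg_cst.
  have h'c : continuous (derive1 h).
    by move=> x; exact/differentiable_continuous/derivable1_diffP.
  exact: (cvg_comp w (derive1 h) (wc z) (h'c _)).
move=> i j; rewrite /linearized_mx /mx_of_seq.
under eq_fun do rewrite mxE.
case: i => -[|[|[|[|//]]]] ilt; case: j => -[|[|[|[|//]]]] jlt /=;
  first [exact: cst_continuous | exact: C1].
Qed.

Lemma expR_cvg0_pinfty {R : realType} (k : R) : k < 0 ->
  expR (k * z) @[z --> +oo_R] --> 0.
Proof.
move=> k0; have kz : - k * z @[z --> +oo_R] --> +oo_R.
  by apply: gt0_cvgMry; [rewrite oppr_gt0|exact: cvg_id].
have := cvg_comp _ _ kz (@cvgr_expR R).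
by apply: cvg_trans; apply: near_eq_cvg; near=> z; rewrite /= mulNr opprK.
Unshelve. all: by end_near. Qed.

Lemma expR_cvg0_ninfty {R : realType} (k : R) : 0 < k ->
  expR (k * z) @[z --> -oo_R] --> 0.
Proof.
move=> k0; apply/cvgNy_compNP; have Nk0 : - k < 0 by rewrite oppr_lt0.
have := expR_cvg0_pinfty Nk0.
by apply: cvg_trans; apply: near_eq_cvg; near=> z; rewrite /= mulrN mulNr.
Unshelve. all: by end_near. Qed.

(** Treats both bundles at once. The limit for the sum of the rates gives isotropy; the one for
    their difference gives dimension two and requires the subdominant solution first. *)
Lemma lagrangian_bundle {R : realType} (f g : R -> R) (sigma alpha c : R) uh vh
    (I : set R) (Ainf : R -> 'M[R]_4) (E : set_system R) {FE : ProperFilter E}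
    mu mu' eta eta' u u' lam z :
  C2_fun f -> C2_fun g -> traveling_wave f g sigma alpha c uh vh ->
  asymptotic_solution I (linearized_mx f g sigma alpha c uh vh) Ainf E mu eta u ->
  asymptotic_solution I (linearized_mx f g sigma alpha c uh vh) Ainf E mu' eta' u' ->
  I lam ->
  expR ((mu lam + mu' lam + c) * t) @[t --> E] --> 0 ->
  expR ((mu lam - mu' lam) * t) @[t --> E] --> 0 ->
  lagrangian (bundle u u' lam z).
Proof.
move=> fC2 gC2 wave usol u'sol Ilam Esum Ediff.
have ulim : expR (- mu lam * t) *: u lam t @[t --> E] --> eta lam.
  exact: asymptotic_solution_lim usol Ilam _.
have u'lim : expR (- mu' lam * t) *: u' lam t @[t --> E] --> eta' lam.
  exact: asymptotic_solution_lim u'sol Ilam _.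
have [uode _ _ /(_ _ Ilam)[eta0 _]] := usol.
have [u'ode _ _ /(_ _ Ilam)[eta'0 _]] := u'sol.
have Du x := uode lam x Ilam; have Du' x := u'ode lam x Ilam.
apply: lagrangian_span.
  exact: (free_solutions Du Du' ulim u'lim
    (linearized_mx_continuous fC2 gC2 wave) eta0 eta'0 Ediff z).
exact: (omega_solutions_eq0 Du Du' ulim u'lim Esum z).
Qed.

(** Needed for the unstable bundle: toward [-oo] the solution with the larger rate [mu4] is the
    subdominant one, so [u4] must precede [u3]. *)
Lemma bundleC {R : realType} (u u' : R -> R -> 'cV[R]_4) lam z :
  bundle u u' lam z = bundle u' u lam z.
Proof. by rewrite /bundle !span_cons span_nil !addv0 addvC. Qed.

Unset Implicit Arguments.

Theorem theorem1 (R : realType) (f g : R -> R) (sigma alpha c : R)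
    (uh vh : R -> R) (nu1 nu2 delta : R) (Ainf : R -> 'M[R]_4)
    (eta1 eta2 eta3 eta4 : R -> 'cV[R]_4)
    (u1 u2 u3 u4 : R -> R -> 'cV[R]_4)
    (f_C2 : C2_fun f) (g_C2 : C2_fun g)
    (alpha_gt0 : 0 < alpha) (sigma_gt0 : 0 < sigma)
    (equilibrium : f 0 = 0 /\ g 0 = 0)
    (trace_lt0 : derive1 f 0 + derive1 g 0 < 0)
    (det_gt0 : 0 < derive1 f 0 * derive1 g 0 + sigma * alpha)
    (wave : traveling_wave f g sigma alpha c uh vh)
    (A1 : c < 0)
    (A2 : [/\ eigenvalue (reaction_jacobian f g sigma alpha) nu1,
              eigenvalue (reaction_jacobian f g sigma alpha) nu2 &
              nu1 < nu2 < 0])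
    (A3 : (ln `|wave_orbit sigma alpha uh vh z| / z @[z --> +oo_R]
             --> mu2 c nu2 0) /\
          (ln `|wave_orbit sigma alpha uh vh z| / z @[z --> -oo_R]
             --> mu3 c nu2 0))
    (A4 : transverse_homoclinic (TW_aug f g sigma alpha)
            (col_of_seq 5 [:: 0; 0; 0; 0; c])
            (wave_orbit_aug sigma alpha c uh vh))
    (Ainf_lim : forall lam : R,
       (linearized_mx f g sigma alpha c uh vh lam z @[z --> +oo_R] --> Ainf lam) /\
       (linearized_mx f g sigma alpha c uh vh lam z @[z --> -oo_R] --> Ainf lam))
    (delta_gt0 : 0 < delta)
    (delta_small : forall lam : R, - delta <= lam ->
       [/\ nu2 < lam,
           mu1 c nu1 lam < mu2 c nu2 lam,
           mu2 c nu2 lam < 0,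
           0 < mu3 c nu2 lam &
           mu3 c nu2 lam < mu4 c nu1 lam])
    (u1_sol : asymptotic_solution [set lam | - delta <= lam]
       (linearized_mx f g sigma alpha c uh vh) Ainf +oo_R (mu1 c nu1) eta1 u1)
    (u2_sol : asymptotic_solution [set lam | - delta <= lam]
       (linearized_mx f g sigma alpha c uh vh) Ainf +oo_R (mu2 c nu2) eta2 u2)
    (u3_sol : asymptotic_solution [set lam | - delta <= lam]
       (linearized_mx f g sigma alpha c uh vh) Ainf -oo_R (mu3 c nu2) eta3 u3)
    (u4_sol : asymptotic_solution [set lam | - delta <= lam]
       (linearized_mx f g sigma alpha c uh vh) Ainf -oo_R (mu4 c nu1) eta4 u4)
    (lam z : R) (lam_ge : - delta <= lam) :
  lagrangian (bundle u1 u2 lam z) /\ lagrangian (bundle u3 u4 lam z).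
Proof.
have [_ mu12 mu20 _ mu34] := delta_small lam lam_ge.
split.
  apply: (lagrangian_bundle z f_C2 g_C2 wave u1_sol u2_sol lam_ge);
    apply: expR_cvg0_pinfty; last by rewrite subr_lt0.
  (* With the square roots as atoms, [mu1 + mu2 + c] is minus half their sum. By [mu20] the root in
     [mu2] exceeds [- c], positive by [A1], and by [mu12] the other root is larger still. *)
  by move: mu12 mu20; rewrite /mu1 /mu2; lra.
rewrite bundleC.
apply: (lagrangian_bundle z f_C2 g_C2 wave u4_sol u3_sol lam_ge);
  apply: expR_cvg0_ninfty; last by rewrite subr_gt0.
(* Likewise [mu3 + mu4 + c] is half the sum of the same two roots. *)
by move: A1 mu12 mu20; rewrite /mu1 /mu2 /mu3 /mu4; lra.
Qed.
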